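(* Let $\Lambda_1,\Lambda_2$ be independent random real diagonal $m\times m$ matrices with finite fourth moments, let $Q_s$ be a random $\beta$-orthogonal permutation-invariant matrix, let $\Pi$ be a uniformly random permutation matrix and $Q$ a $\beta$-Haar distributed $\beta$-orthogonal matrix, with each of $Q_s,\Pi,Q$ independent of $(\Lambda_1,\Lambda_2)$. Set $$M=\Lambda_1+Q_s^{-1}\Lambda_2Q_s,\quad M_c=\Lambda_1+\Pi^{-1}\Lambda_2\Pi,\quad M_f=\Lambda_1+Q^{-1}\Lambda_2Q,$$ and $m_4=\varphi[M^4]$, $m_4^c=\varphi[M_c^4]$, $m_4^f=\varphi[M_f^4]$. Assume $\mathbb{E}[\tilde\kappa_2(\Lambda_1)\tilde\kappa_2(\Lambda_2)]\ne 0$. Then the number $p$ defined by $m_4=p\,m_4^f+(1-p)\,m_4^c$ is independent of the distributions of $\Lambda_1,\Lambda_2$ and equals $$p=\frac{m_4^c-m_4}{m_4^c-m_4^f}=\frac{1-m\,\mathbb{E}(|q_s|^4)}{1-m\,\mathbb{E}(|q|^4)},$$ where $q_s$ is any entry of $Q_s$ and $q$ is any entry of $Q$. Since $1-m\mathbb{E}(|q|^4)=\frac{(m-1)\beta}{m\beta+2}\to1$ as $m\to\infty$, $p$ is asymptotically $1-m\,\mathbb{E}(|q_s|^4)$.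
   Context: Fix integers $m\ge 2$ and $\beta\in\{1,2,4\}$. A $\beta$-orthogonal matrix is an $m\times m$ real orthogonal ($\beta=1$), complex unitary ($\beta=2$) or quaternionic unitary/symplectic ($\beta=4$) matrix; $U^{-1}=U^{*}$. A random $\beta$-orthogonal matrix $U$ is called permutation invariant if for all $m\times m$ permutation matrices $\Pi_1,\Pi_2$ the joint distribution of the entries of $\Pi_1U\Pi_2$ equals that of $U$. For a random $m\times m$ matrix $X$, $\varphi[X]:=\frac1m\mathbb{E}\,\mathrm{Tr}\,X$ (for $\beta=4$, $\mathrm{Tr}$ denotes the real part of the trace). For a diagonal matrix $\mathrm{diag}(x_1,\dots,x_m)$, $\tilde\kappa_2:=\frac1m\sum_i x_i^2-\frac{1}{m(m-1)}\sum_{i\neq j}x_ix_j$. Known fact used: for a $\beta$-Haar matrix, every entry $q$ satisfies $\mathbb{E}|q|^4=\frac{\beta+2}{m(m\beta+2)}$. *)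

(* Defs.v *)
From HB Require Import structures.
From mathcomp Require Import all_boot all_order all_algebra ring.
From mathcomp Require Import all_classical all_reals all_analysis.
From mathcomp Require Import fingroup perm.
Set Implicit Arguments. Unset Strict Implicit. Unset Printing Implicit Defensive.
Import Order.TTheory GRing.Theory Num.Theory.
Local Open Scope ring_scope.

Record quat (R : Type) := Quat { qre : R; qi : R; qj : R; qk : R }.

Definition quat_tuple (R : Type) (x : quat R) := (qre x, qi x, qj x, qk x).
Definition tuple_quat (R : Type) (p : R * R * R * R) :=
  let: (a, b, c, d) := p in Quat a b c d.
Lemma quat_tupleK (R : Type) : cancel (@quat_tuple R) (@tuple_quat R).
Proof. by case. Qed.

HB.instance Definition _ (R : choiceType) :=
  Choice.copy (quat R) (can_type (@quat_tupleK R)).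

Definition qzero (R : comNzRingType) : quat R := Quat 0 0 0 0.
Definition qone (R : comNzRingType) : quat R := Quat 1 0 0 0.
Definition qadd (R : comNzRingType) (x y : quat R) :=
  Quat (qre x + qre y) (qi x + qi y) (qj x + qj y) (qk x + qk y).
Definition qopp (R : comNzRingType) (x : quat R) :=
  Quat (- qre x) (- qi x) (- qj x) (- qk x).
Definition qmul (R : comNzRingType) (x y : quat R) :=
  Quat (qre x * qre y - qi x * qi y - qj x * qj y - qk x * qk y)
       (qre x * qi y + qi x * qre y + qj x * qk y - qk x * qj y)
       (qre x * qj y - qi x * qk y + qj x * qre y + qk x * qi y)
       (qre x * qk y + qi x * qj y - qj x * qi y + qk x * qre y).

Lemma quat_ring_axioms (R : comNzRingType) :
  [/\ associative (@qadd R), commutative (@qadd R), left_id (@qzero R) (@qadd R),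
      left_inverse (@qzero R) (@qopp R) (@qadd R) &
   [/\ associative (@qmul R), left_id (@qone R) (@qmul R),
       right_id (@qone R) (@qmul R), left_distributive (@qmul R) (@qadd R) &
       right_distributive (@qmul R) (@qadd R)]].
Proof.
split; try split; do ?[case=> ? ? ? ?]; rewrite /qadd /qmul /qopp /=;
  congr Quat; ring.
Qed.

Lemma qone_neq0 (R : comNzRingType) : @qone R != @qzero R.
Proof. by apply/eqP => -[] /eqP; rewrite oner_eq0. Qed.

Definition quat_ring_mixin (R : comNzRingType) :=
  let: And5 a b c d (And5 e f g h i) := quat_ring_axioms R in
  @GRing.isNzRing.Build (quat R) (@qzero R) (@qopp R) (@qadd R) (@qone R) (@qmul R)
    a b c d e f g h i (qone_neq0 R).
HB.instance Definition _ (R : comNzRingType) := quat_ring_mixin R.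

Local Open Scope classical_set_scope.
Local Open Scope ring_scope.

Definition qconj (R : comNzRingType) (x : quat R) :=
  Quat (qre x) (- qi x) (- qj x) (- qk x).
Definition qnorm2 (R : comNzRingType) (x : quat R) :=
  qre x ^+ 2 + qi x ^+ 2 + qj x ^+ 2 + qk x ^+ 2.
Definition qreal (R : comNzRingType) (r : R) : quat R := Quat r 0 0 0.
Definition qcoord (R : Type) (k : 'I_4) (x : quat R) : R :=
  match val k with 0 => qre x | 1 => qi x | 2 => qj x | _ => qk x end.

(* R (beta=1), C = R + R i (beta=2), H (beta=4) as subsets of H *)
Definition in_beta (R : comNzRingType) (beta : nat) (x : quat R) : bool :=
  if beta == 1%N then [&& qi x == 0, qj x == 0 & qk x == 0]
  else if beta == 2%N then (qj x == 0) && (qk x == 0)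
  else true.

Definition adjmx (R : comNzRingType) (m : nat) (U : 'M[quat R]_m) : 'M[quat R]_m :=
  \matrix_(i, j) qconj (U j i).

Definition beta_orthogonal (R : comNzRingType) (beta m : nat) (U : 'M[quat R]_m) :=
  (forall i j, in_beta beta (U i j)) /\
  U *m adjmx U = 1%:M /\ adjmx U *m U = 1%:M.

Definition rdiag (R : comNzRingType) (m : nat) (x : 'I_m -> R) : 'M[quat R]_m :=
  diag_mx (\row_i qreal (x i)).

Definition mxpow4 (R : comNzRingType) (m : nat) (A : 'M[quat R]_m) :=
  A *m A *m A *m A.

Definition kappa2 (R : realType) (m : nat) (x : 'I_m -> R) : R :=
  m%:R^-1 * \sum_i x i ^+ 2
  - (m%:R * (m%:R - 1))^-1 * \sum_i \sum_(j | j != i) x i * x j.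

Definition Ex d (T : measurableType d) (R : realType) (P : probability T R)
  (f : T -> R) : R := Rintegral P setT f.

Definition mxcoords (R : Type) (T : Type) (m : nat) (X : T -> 'M[quat R]_m) :
  'I_m * 'I_m * 'I_4 -> T -> R :=
  fun p t => qcoord p.2 (X t p.1.1 p.1.2).

Definition rv_family d (T : measurableType d) (R : realType) (I : finType)
  (X : I -> T -> R) := forall i, measurable_fun setT (X i).

Definition fam_event (T : Type) (R : Type) (I : finType) (X : I -> T -> R)
  (A : I -> set R) : set T := [set t | forall i, A i (X i t)].

Definition same_law d (T : measurableType d) (R : realType) (P : probability T R)
  (I : finType) (X Y : I -> T -> R) :=
  forall A : I -> set R, (forall i, measurable (A i)) ->
    P (fam_event X A) = P (fam_event Y A).

Definition indep d (T : measurableType d) (R : realType) (P : probability T R)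
  (I J : finType) (X : I -> T -> R) (Y : J -> T -> R) :=
  forall (A : I -> set R) (B : J -> set R),
    (forall i, measurable (A i)) -> (forall j, measurable (B j)) ->
    P (fam_event X A `&` fam_event Y B) = (P (fam_event X A) * P (fam_event Y B))%E.

Definition pairfam (T R : Type) (m : nat) (L1 L2 : 'I_m -> T -> R) :
  'I_m + 'I_m -> T -> R :=
  fun s => match s with inl i => L1 i | inr i => L2 i end.

Definition random_beta_orth d (T : measurableType d) (R : realType)
  (beta m : nat) (U : T -> 'M[quat R]_m) :=
  rv_family (mxcoords U) /\ forall t, beta_orthogonal beta (U t).

Definition perm_invariant d (T : measurableType d) (R : realType) (P : probability T R)
  (m : nat) (U : T -> 'M[quat R]_m) :=
  forall s1 s2 : 'S_m,
    same_law P (mxcoords U) (mxcoords (fun t => perm_mx s1 *m U t *m perm_mx s2)).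

Definition beta_haar d (T : measurableType d) (R : realType) (P : probability T R)
  (beta m : nat) (U : T -> 'M[quat R]_m) :=
  random_beta_orth beta U /\
  forall V : 'M[quat R]_m, beta_orthogonal beta V ->
    same_law P (mxcoords U) (mxcoords (fun t => V *m U t)) /\
    same_law P (mxcoords U) (mxcoords (fun t => U t *m V)).

Definition uniform_perm d (T : measurableType d) (R : realType) (P : probability T R)
  (m : nat) (sigma : T -> 'S_m) :=
  forall s : 'S_m, measurable (sigma @^-1` [set s]) /\
    P (sigma @^-1` [set s]) = ((m`!)%:R^-1)%:E.

Definition phi4 d (T : measurableType d) (R : realType) (P : probability T R)
  (m : nat) (X : T -> 'M[quat R]_m) : R :=
  Ex P (fun t => m%:R^-1 * qre (\tr (mxpow4 (X t)))).

(* Main.v *)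
(* For a permutation-invariant unitary [U] independent of [A = diag a] and
   [D = diag b], put [B = U^* D U].  In [phi ((A + B)^4)] only the word [ABAB]
   sees more of the law of [U] than [E |u|^2 = 1/m].  Its coefficients are the
   means of [Re (conj u_ki u_kj conj u_lj u_li)]; by invariance these depend only
   on whether [i = j] and [k = l], and unitarity (fixed row and column sums)
   expresses all of them through [E |u|^4].  The outcome is
   [phi ((A + B)^4) = C - 2 (1 - m E |u|^4) E (kappa2 a * kappa2 b)]
   with [C] independent of [U].  For a random permutation [1 - m E |u|^4] vanishes,
   so [C] is the classical moment, and the three values of the formula give [p]. *)

Require Import Defs.
From HB Require Import structures.
From mathcomp Require Import all_boot all_order all_algebra ring lra.
From mathcomp Require Import all_classical all_reals all_analysis.
From mathcomp Require Import fingroup perm measurable_realfun.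
Set Implicit Arguments. Unset Strict Implicit. Unset Printing Implicit Defensive.
Import Order.TTheory GRing.Theory Num.Theory.
Import numFieldNormedType.Exports.
Local Open Scope classical_set_scope.
Local Open Scope ring_scope.

(** * Laws of finite families of real random variables *)

Definition rectangles (R : realType) (I : finType) : set (set (I -> R)) :=
  [set E | exists2 A : I -> set R, forall i, measurable (A i) &
    E = [set z | forall i, A i (z i)]].

(** [same_law] and [indep] test events on rectangles only. The rectangles generate this
    sigma-algebra and are stable under intersection, so they determine a finite law on it. *)
Notation family_space R I := (g_sigma_algebraType (@rectangles R I)).

Lemma measurable_coord (R : realType) (I : finType) (i : I) :
  measurable_fun setT (fun z : family_space R I => z i).
Proof.
move=> _ B mB; rewrite setTI; apply: sub_sigma_algebra.
exists (fun j => if j == i then B else setT).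
  by move=> j; case: ifP.
apply/seteqP; split=> z /=.
  by move=> Bz j; case: eqP => [->|].
by move/(_ i); rewrite eqxx.
Qed.

Lemma measurable_family d (T : measurableType d) (R : realType) (I : finType)
    (X : I -> T -> R) : rv_family X ->
  measurable_fun setT (fun t => (fun i => X i t) : family_space R I).
Proof.
move=> mX; apply: (@measurability _ _ T (family_space R I) setT
  (fun t i => X i t) (@rectangles R I)) => //.
move=> _ [_ [A mA ->] <-]; rewrite setTI.
rewrite [X in measurable X](_ : _ = \bigcap_(i in [set: I]) (X i @^-1` A i)).
  apply: fin_bigcap_measurable; first exact: finite_finset.
  by move=> i _; rewrite -[_ @^-1` _]setTI; apply: mX.
by apply/seteqP; split=> t /= h i; [move=> _|]; apply: h.
Qed.

Section equal_laws.
Context d d' (T : measurableType d) (T' : measurableType d') (R : realType).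
Variables (P : {finite_measure set T -> \bar R}) (P' : {measure set T' -> \bar R}).
Variables (I : finType) (X : I -> T -> R) (X' : I -> T' -> R).
Hypotheses (mX : rv_family X) (mX' : rv_family X').
Hypothesis eqXX' : forall A : I -> set R, (forall i, measurable (A i)) ->
  P (fam_event X A) = P' (fam_event X' A).

(** Uniqueness of measures extends the equality of laws from rectangles to all events; the positive
    and negative parts of [F] are then compared separately. [P] and [P'] may live on different
    spaces, so that [P'] can be a product measure. *)
Lemma equal_laws_integral (F : family_space R I -> R) :
  measurable_fun setT F ->
  (\int[P]_t (F (X^~ t))%:E = \int[P']_t (F (X'^~ t))%:E)%E.
Proof.
move=> mF.
pose XX := mfun_Sub (mem_set (measurable_family mX)).
pose XX' := mfun_Sub (mem_set (measurable_family mX')).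
have eqlaw B : measurable B -> pushforward P XX B = pushforward P' XX' B.
  apply: (@measure_unique _ R (family_space R I) (@rectangles R I) (fun=> setT)) => //.
  - move=> _ _ [A mA ->] [B' mB ->]; exists (fun i => A i `&` B' i).
      by move=> i; exact: measurableI.
    apply/seteqP; split=> z /=; first by move=> [hA hB] i; split.
    by move=> h; split=> i; have [] := h i.
  - move=> n; exists (fun=> setT) => //.
    by apply/seteqP; split.
  - by rewrite bigcup_const//; exists 0%N.
  - by move=> _ [A mA ->]; exact: eqXX'.
  - by move=> n; rewrite /= /pushforward preimage_setT; exact: fin_num_fun_lty.
have eqint (G : family_space R I -> \bar R) :
    measurable_fun setT G ->
    (forall z, 0 <= G z)%E ->
    (\int[P]_t (G (X^~ t)) = \int[P']_t (G (X'^~ t)))%E.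
  move=> mG G0.
  have -> : (\int[P]_t (G (X^~ t)) = \int[pushforward P XX]_z G z)%E.
    by rewrite (@ge0_integral_pushforward _ _ _ _ _ XX)//.
  have -> : (\int[P']_t (G (X'^~ t)) = \int[pushforward P' XX']_z G z)%E.
    by rewrite (@ge0_integral_pushforward _ _ _ _ _ XX')//.
  by apply: eq_measure_integral => B mB _; exact: eqlaw.
have mFE : measurable_fun setT (EFin \o F) by exact/measurable_EFinP.
rewrite [LHS]integralE [RHS]integralE; congr (_ - _)%E.
  under eq_integral do rewrite (funepos_comp (EFin \o F) (fun t => X^~ t)).
  under [RHS]eq_integral do rewrite (funepos_comp (EFin \o F) (fun t => X'^~ t)).
  exact: (eqint _ (measurable_funepos mFE)).
under eq_integral do rewrite (funeneg_comp (EFin \o F) (fun t => X^~ t)).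
under [RHS]eq_integral do rewrite (funeneg_comp (EFin \o F) (fun t => X'^~ t)).
exact: (eqint _ (measurable_funeneg mFE)).
Qed.

End equal_laws.

Lemma same_law_Ex d (T : measurableType d) (R : realType)
    (P : probability T R) (I : finType) (X Y : I -> T -> R)
    (F : family_space R I -> R) :
  rv_family X -> rv_family Y -> same_law P X Y -> measurable_fun setT F ->
  Ex P (fun t => F (X^~ t)) = Ex P (fun t => F (Y^~ t)).
Proof.
move=> mX mY XY mF; rewrite /Ex /Rintegral; congr fine.
exact: (equal_laws_integral mX mY XY).
Qed.

(** * The product rule for expectations of independent families *)

Section indep_product.
Context d (T : measurableType d) (R : realType) (P : probability T R).
Variables (I J : finType) (X : I -> T -> R) (Y : J -> T -> R).
Hypotheses (mX : rv_family X) (mY : rv_family Y) (XY : indep P X Y).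

Let Z (s : I + J) (t : T) := match s with inl i => X i t | inr j => Y j t end.
Let Z' (s : I + J) (t : T * T) :=
  match s with inl i => X i t.1 | inr j => Y j t.2 end.

Let mZ : rv_family Z.
Proof. by case=> i; [exact: mX|exact: mY]. Qed.

Let mZ' : rv_family Z'.
Proof.
by case=> i; [apply: (measurableT_comp (mX i))|apply: (measurableT_comp (mY i))].
Qed.

Let ZZ' (A : I + J -> set R) : (forall s, measurable (A s)) ->
  P (fam_event Z A) = (P \x P)%E (fam_event Z' A).
Proof.
move=> mA.
have -> : fam_event Z A =
    fam_event X (A \o inl) `&` fam_event Y (A \o inr).
  apply/seteqP; split=> t /=.
    by move=> h; split=> i; [exact: (h (inl i))|exact: (h (inr i))].
  by move=> [hA hB] [i|i]; [exact: hA|exact: hB].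
have -> : fam_event Z' A =
    fam_event X (A \o inl) `*` fam_event Y (A \o inr).
  apply/seteqP; split=> t /=.
    by move=> h; split=> i; [exact: (h (inl i))|exact: (h (inr i))].
  by move=> [hA hB] [i|i]; [exact: hA|exact: hB].
have mE (K : finType) (W : K -> T -> R) (B : K -> set R) : rv_family W ->
    (forall k, measurable (B k)) -> measurable (fam_event W B).
  move=> mW mB.
  have := measurable_family mW measurableT.
  move=> /(_ [set z | forall i, B i (z i)]); rewrite setTI; apply.
  by apply: sub_sigma_algebra; exists B.
rewrite XY; [|by move=> i; exact: mA..].
by rewrite product_measure1E//; apply: mE => // i; exact: mA.
Qed.

(** Independence says that the joint family [Z] has under [P] the law of the decoupled family [Z']
    under [P \x P]. The expectation moves to the product space, where Fubini factors it. *)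
Lemma indep_integrable_Ex (F : family_space R I -> R) (G : family_space R J -> R) :
  measurable_fun setT F -> measurable_fun setT G ->
  P.-integrable setT (fun t => (F (X^~ t))%:E) ->
  P.-integrable setT (fun t => (G (Y^~ t))%:E) ->
  Ex P (fun t => F (X^~ t) * G (Y^~ t)) =
  Ex P (fun t => F (X^~ t)) * Ex P (fun t => G (Y^~ t)).
Proof.
move=> mF mG iF iG.
have mproj (K : finType) (e : K -> I + J) :
    measurable_fun setT (fun z : family_space R (I + J)%type =>
      (fun k => z (e k)) : family_space R K).
  by apply: measurable_family => k; exact: measurable_coord.
pose H (z : family_space R (I + J)%type) :=
  F (fun i => z (inl i)) * G (fun j => z (inr j)).
have mH : measurable_fun setT H.
  apply: measurable_funM.
    exact: (measurableT_comp mF (mproj _ inl)).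
  exact: (measurableT_comp mG (mproj _ inr)).
have mFX := measurableT_comp mF (measurable_family mX).
have mGY := measurableT_comp mG (measurable_family mY).
have E1 := equal_laws_integral mZ mZ' ZZ' mH.
rewrite /H /= in E1.
rewrite /Ex /Rintegral E1.
have mprod : measurable_fun setT
    (fun p : T * T => (F (X^~ p.1) * G (Y^~ p.2))%:E).
  apply/measurable_EFinP; apply: measurable_funM.
    exact: (measurableT_comp mFX).
  exact: (measurableT_comp mGY).
(* By Tonelli: the iterated integral of the absolute value is a product of two finite integrals. *)
have iprod : (P \x P)%E.-integrable setT
    (fun p : T * T => (F (X^~ p.1) * G (Y^~ p.2))%:E).
  apply/integrable12ltyP => //=.
  under eq_integral => x _.
    under eq_integral => y _ do rewrite normrM EFinM.
    rewrite ge0_integralZl//; last first.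
      by apply/measurable_EFinP; apply: measurableT_comp.
    over.
  rewrite ge0_integralZr//=; last 2 first.
  - by apply/measurable_EFinP; apply: measurableT_comp.
  - by apply: integral_ge0 => y _; rewrite lee_fin.
  by move/integrableP: iF => [_ hF]; move/integrableP: iG => [_ hG];
    rewrite lte_mul_pinfty// ?ge0_fin_numE ?integral_ge0//.
rewrite -integral12_prod_meas1// /fubini_F /=.
under eq_integral => x _.
  under eq_integral => y _ do rewrite EFinM.
  rewrite integralZl// -[X in (_ * X)%E]fineK; last exact: integrable_fin_num.
  over.
rewrite /= integralZr// fineM//; exact: integrable_fin_num.
Qed.

End indep_product.

(** * Quaternion algebra *)

Section quaternions.
Context (R : comNzRingType).
Implicit Types x y : quat R.

(* The ring structure of [quat R] is built by matching on the opaque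
   [quat_ring_axioms], so its operations do not compute. *)
Lemma quat0E : 0 = @qzero R.
Proof.
change (GRing.isNzRing.zero (quat_ring_mixin R) = @qzero R).
by rewrite /quat_ring_mixin; case: (quat_ring_axioms R) => ? ? ? ? [].
Qed.

Lemma quat1E : 1 = @qone R.
Proof.
change (GRing.isNzRing.one (quat_ring_mixin R) = @qone R).
by rewrite /quat_ring_mixin; case: (quat_ring_axioms R) => ? ? ? ? [].
Qed.

Lemma quatDE x y : x + y = qadd x y.
Proof.
change (GRing.isNzRing.add (quat_ring_mixin R) x y = qadd x y).
by rewrite /quat_ring_mixin; case: (quat_ring_axioms R) => ? ? ? ? [].
Qed.

Lemma quatME x y : x * y = qmul x y.
Proof.
change (GRing.isNzRing.mul (quat_ring_mixin R) x y = qmul x y).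
by rewrite /quat_ring_mixin; case: (quat_ring_axioms R) => ? ? ? ? [].
Qed.

Lemma quatP x y : qre x = qre y -> qi x = qi y -> qj x = qj y -> qk x = qk y ->
  x = y.
Proof. by case: x => ????; case: y => ???? /= -> -> -> ->. Qed.

Lemma qreD x y : qre (x + y) = qre x + qre y.
Proof. by rewrite quatDE. Qed.

Lemma qre_sum (I : finType) (F : I -> quat R) :
  qre (\sum_i F i) = \sum_i qre (F i).
Proof. by apply: (big_morph (@qre R) qreD); rewrite quat0E. Qed.

Lemma qre_mulC x y : qre (x * y) = qre (y * x).
Proof. by case: x => ????; case: y => ????; rewrite ?quatME /=; ring. Qed.

Lemma qreal_comm (r : R) x : x * qreal r = qreal r * x.
Proof. by case: x => ????; apply: quatP; rewrite ?quatME /=; ring. Qed.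

Lemma qrealM (r s : R) : qreal (r * s) = qreal r * qreal s.
Proof. by apply: quatP; rewrite ?quatME /=; ring. Qed.

Lemma qre_scale (r : R) x : qre (qreal r * x) = r * qre x.
Proof. by rewrite ?quatME /=; ring. Qed.

Lemma qnorm2M x y : qnorm2 (x * y) = qnorm2 x * qnorm2 y.
Proof. by case: x => ????; case: y => ????; rewrite ?quatME /qnorm2 /=; ring. Qed.

Lemma qnorm2_conj x : qnorm2 (qconj x) = qnorm2 x.
Proof. by case: x => ????; rewrite ?quatME /qnorm2 /=; ring. Qed.

Lemma mulVq x : qconj x * x = qreal (qnorm2 x).
Proof. by case: x => ????; apply: quatP; rewrite ?quatME /qnorm2 /=; ring. Qed.

End quaternions.

(** * Expansion of a fourth power under a tracial functional *)

Lemma tracial_pow4D (R : comPzRingType) (S : pzRingType) (t : S -> R) (A B : S) :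
  (forall x y, t (x + y) = t x + t y) -> (forall x y, t (x * y) = t (y * x)) ->
  t ((A + B) * (A + B) * (A + B) * (A + B)) =
    t (A * A * A * A) + t (B * B * B * B)
    + 4 * t (A * A * A * B) + 4 * t (A * A * B * B)
    + 4 * t (A * B * B * B) + 2 * t (A * B * A * B).
Proof.
move=> tD tC.
(* The sixteen words form six cyclic classes, of sizes 1, 1, 4, 4, 4 and 2. Each [e] rotates a word
   by one letter; applied from the far end of each chain, they bring every word to the
   representative of its class. *)
have cyc X Y Z W : t (X * Y * Z * W) = t (W * X * Y * Z) by rewrite tC !mulrA.
have e1 := cyc A A B A; have e2 := cyc A B A A; have e3 := cyc B A A A.
have e4 := cyc A B B A; have e5 := cyc B B A A; have e6 := cyc B A A B.
have e7 := cyc B A B A.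
have e8 := cyc B B B A; have e9 := cyc B B A B; have e10 := cyc B A B B.
rewrite !(mulrDl, mulrDr) !tD.
rewrite e3 e2 e1 e6 e5 e4 e7 e10 e9 e8.
ring.
Qed.

Section trace_word_expansion.
Context (R : comNzRingType) (m : nat).
Implicit Types A B : 'M[quat R]_m.

(** Quaternions do not commute, so the trace itself is not cyclic; its real part is, because
    [qre (x * y) = qre (y * x)]. *)
Definition retr A := qre (\tr A).

Lemma retrD A B : retr (A + B) = retr A + retr B.
Proof. by rewrite /retr raddfD qreD. Qed.

Lemma retr_mulC A B : retr (A *m B) = retr (B *m A).
Proof.
rewrite /retr /mxtrace !qre_sum.
under eq_bigr do rewrite mxE qre_sum.
under [RHS]eq_bigr do rewrite mxE qre_sum.
rewrite exchange_big; apply: eq_bigr => i _; apply: eq_bigr => j _.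
exact: qre_mulC.
Qed.

Lemma retr_pow4D A B :
  retr (mxpow4 (A + B)) = retr (A *m A *m A *m A) + retr (B *m B *m B *m B)
    + 4 * retr (A *m A *m A *m B) + 4 * retr (A *m A *m B *m B)
    + 4 * retr (A *m B *m B *m B) + 2 * retr (A *m B *m A *m B).
Proof. exact: (@tracial_pow4D R 'M[quat R]_m retr A B retrD retr_mulC). Qed.

End trace_word_expansion.

(** * Trace words in a diagonal and a conjugated diagonal matrix *)

Section conjugated_diagonal.
Context (R : comNzRingType) (m : nat).
Implicit Types (U : 'M[quat R]_m) (x y a b : 'I_m -> R).

Definition conj_diag U x := adjmx U *m rdiag x *m U.

(* The [a_i a_j b_k b_l]-coefficient of [Re Tr (A B A B)], where [A = diag a]
   and [B = U^* diag(b) U]. *)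
Definition quad U i j k l :=
  qre (qconj (U k i) * U k j * (qconj (U l j) * U l i)).

Lemma rdiag_mulE x (A : 'M[quat R]_m) i j : (rdiag x *m A) i j = qreal (x i) * A i j.
Proof. by rewrite /rdiag mul_diag_mx !mxE. Qed.

Lemma rdiagM x y : rdiag x *m rdiag y = rdiag (fun i => x i * y i).
Proof.
apply/matrixP => i j; rewrite rdiag_mulE !mxE.
by case: eqP => _; rewrite ?mulr1n ?mulr0n ?mulr0 ?qrealM.
Qed.

Lemma conj_diagE U x i j :
  conj_diag U x i j = \sum_k qreal (x k) * (qconj (U k i) * U k j).
Proof.
rewrite /conj_diag -mulmxA mxE; apply: eq_bigr => k _.
by rewrite rdiag_mulE mxE mulrA qreal_comm mulrA.
Qed.

Lemma conj_diagM U x y : U *m adjmx U = 1%:M ->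
  conj_diag U x *m conj_diag U y = conj_diag U (fun i => x i * y i).
Proof.
move=> UU; rewrite /conj_diag -rdiagM !mulmxA.
by rewrite -(mulmxA _ U) UU mulmx1.
Qed.

Lemma retr_rdiag x : retr (rdiag x) = \sum_i x i.
Proof.
by rewrite /retr /mxtrace qre_sum; apply: eq_bigr => i _; rewrite !mxE eqxx.
Qed.

Lemma retr_conj_diag U x : U *m adjmx U = 1%:M ->
  retr (conj_diag U x) = \sum_i x i.
Proof.
by move=> UU; rewrite /conj_diag -mulmxA retr_mulC -mulmxA UU mulmx1 retr_rdiag.
Qed.

Lemma retr_rdiag_conj U x y : retr (rdiag x *m conj_diag U y) =
  \sum_i \sum_k x i * y k * qnorm2 (U k i).
Proof.
rewrite /retr /mxtrace qre_sum; apply: eq_bigr => i _.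
rewrite rdiag_mulE conj_diagE qre_scale qre_sum mulr_sumr.
by apply: eq_bigr => k _; rewrite qre_scale mulVq mulrA.
Qed.

Lemma retr_rdiag_conj2 U a b :
  retr (rdiag a *m conj_diag U b *m (rdiag a *m conj_diag U b)) =
  \sum_i \sum_j \sum_k \sum_l a i * a j * b k * b l * quad U i j k l.
Proof.
rewrite /retr /mxtrace qre_sum; apply: eq_bigr => i _.
rewrite mxE qre_sum; apply: eq_bigr => j _.
rewrite !rdiag_mulE !conj_diagE.
have swap (r s : R) (X Y : quat R) :
    qre (qreal r * X * (qreal s * Y)) = r * s * qre (X * Y).
  by rewrite -mulrA qre_scale (mulrA X) qreal_comm -mulrA qre_scale mulrA.
rewrite swap.
rewrite mulr_suml qre_sum mulr_sumr; apply: eq_bigr => k _.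
rewrite mulr_sumr qre_sum mulr_sumr; apply: eq_bigr => l _.
by rewrite swap /quad !mulrA.
Qed.

(** Unitarity turns a power of the conjugated diagonal into the conjugate of a power, so words whose
    conjugated letters are adjacent involve at most squared moduli of entries. Only the alternating
    word keeps [quad]. *)
Lemma retr_pow4_conj U a b : U *m adjmx U = 1%:M ->
  retr (mxpow4 (rdiag a + conj_diag U b)) =
    \sum_i a i ^+ 4 + \sum_i b i ^+ 4
    + 4 * (\sum_i \sum_k a i * a i * a i * b k * qnorm2 (U k i))
    + 4 * (\sum_i \sum_k a i * a i * b k * b k * qnorm2 (U k i))
    + 4 * (\sum_i \sum_k a i * b k * b k * b k * qnorm2 (U k i))
    + 2 * (\sum_i \sum_j \sum_k \sum_l a i * a j * b k * b l * quad U i j k l).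
Proof.
move=> UU; pose A := rdiag a; pose B := conj_diag U b.
have BB : B *m B = conj_diag U (fun i => b i * b i) by rewrite conj_diagM.
have BBB : B *m B *m B = conj_diag U (fun i => b i * b i * b i).
  by rewrite BB conj_diagM.
have e1 : retr (A *m A *m A *m A) = \sum_i a i ^+ 4.
  by rewrite !rdiagM retr_rdiag; apply: eq_bigr => i _; ring.
have e2 : retr (B *m B *m B *m B) = \sum_i b i ^+ 4.
  by rewrite BBB conj_diagM// retr_conj_diag//; apply: eq_bigr => i _; ring.
have e3 : retr (A *m A *m A *m B) =
    \sum_i \sum_k a i * a i * a i * b k * qnorm2 (U k i).
  by rewrite !rdiagM retr_rdiag_conj.
have e4 : retr (A *m A *m B *m B) =
    \sum_i \sum_k a i * a i * b k * b k * qnorm2 (U k i).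
  rewrite rdiagM -(mulmxA (rdiag _) B B) BB retr_rdiag_conj.
  by apply: eq_bigr => i _; apply: eq_bigr => k _; rewrite !mulrA.
have e5 : retr (A *m B *m B *m B) =
    \sum_i \sum_k a i * b k * b k * b k * qnorm2 (U k i).
  rewrite -(mulmxA A B B) -(mulmxA A (B *m B) B) BBB retr_rdiag_conj.
  by apply: eq_bigr => i _; apply: eq_bigr => k _; rewrite !mulrA.
have e6 : retr (A *m B *m A *m B) =
    \sum_i \sum_j \sum_k \sum_l a i * a j * b k * b l * quad U i j k l.
  by rewrite -(mulmxA (A *m B) A B) retr_rdiag_conj2.
rewrite -e1 -e2 -e3 -e4 -e5 -e6; exact (retr_pow4D A B).
Qed.

(** Only the last two factors of [quad] depend on [l], and they sum to the [(j, i)] entry of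
    [adjmx U *m U]. *)
Lemma sum_quad_row U i j k : adjmx U *m U = 1%:M ->
  \sum_l quad U i j k l = if i == j then qnorm2 (U k i) else 0.
Proof.
move=> UU; rewrite -qre_sum -mulr_sumr.
have -> : \sum_l qconj (U l j) * U l i = (adjmx U *m U) j i.
  by rewrite mxE; apply: eq_bigr => l _; rewrite mxE.
rewrite UU mxE eq_sym; case: eqP => [<-|_].
  by rewrite mulr1 mulVq.
by rewrite mulr0 quat0E.
Qed.

(** With [l = k] the two middle factors are [U k j] and its conjugate, which sum over [j] to a
    diagonal entry of [U *m adjmx U]. *)
Lemma sum_quad_col U i k : U *m adjmx U = 1%:M ->
  \sum_j quad U i j k k = qnorm2 (U k i).
Proof.
move=> UU; rewrite -qre_sum.
have -> : \sum_j qconj (U k i) * U k j * (qconj (U k j) * U k i) =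
    qconj (U k i) * (\sum_j U k j * qconj (U k j)) * U k i.
  by rewrite mulr_sumr mulr_suml; apply: eq_bigr => j _; rewrite !mulrA.
have -> : \sum_j U k j * qconj (U k j) = (U *m adjmx U) k k.
  by rewrite mxE; apply: eq_bigr => l _; rewrite mxE.
by rewrite UU mxE eqxx mulr1 mulVq.
Qed.

Lemma quad_diag U i k : quad U i i k k = qnorm2 (U k i) ^+ 2.
Proof. by rewrite /quad !mulVq -qrealM expr2. Qed.

Lemma sum_qnorm2 U i : adjmx U *m U = 1%:M -> \sum_k qnorm2 (U k i) = 1.
Proof.
move=> UU; transitivity (qre ((adjmx U *m U) i i)).
  by rewrite mxE qre_sum; apply: eq_bigr => k _; rewrite mxE mulVq.
by rewrite UU mxE eqxx quat1E.
Qed.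

End conjugated_diagonal.

(** * Bounds on unitary entries, integrability and expectation *)

Section bounds.
Context (R : realType) (m : nat).
Implicit Types (U : 'M[quat R]_m).

Lemma qnorm2_ge0 (x : quat R) : 0 <= qnorm2 x.
Proof. by rewrite /qnorm2 !addr_ge0// sqr_ge0. Qed.

Lemma normr_qre_le1 (x : quat R) : qnorm2 x <= 1 -> `|qre x| <= 1.
Proof.
move=> x1; rewrite -(@expr_le1 _ 2)// real_normK ?num_real// (le_trans _ x1)//.
by rewrite /qnorm2 -!addrA lerDl !addr_ge0// sqr_ge0.
Qed.

Lemma qnorm2_le1 U k i : adjmx U *m U = 1%:M -> qnorm2 (U k i) <= 1.
Proof.
move=> /(@sum_qnorm2 _ _ _ i) <-; rewrite [leRHS](bigD1 k)//= lerDl.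
by apply: sumr_ge0 => l _; exact: qnorm2_ge0.
Qed.

(** The norm is multiplicative and no entry of a unitary matrix exceeds one. Boundedness makes
    [quad], and its products with integrable functions, integrable. *)
Lemma quad_le1 U i j k l : adjmx U *m U = 1%:M -> `|quad U i j k l| <= 1.
Proof.
move=> UU; apply: normr_qre_le1; rewrite !qnorm2M !qnorm2_conj.
by rewrite !mulr_ile1 ?mulr_ge0 ?qnorm2_ge0 ?qnorm2_le1.
Qed.

End bounds.

Section expectation.
Context d (T : measurableType d) (R : realType) (P : probability T R).
Implicit Types f g : T -> R.

Lemma integrable_sumR (I : finType) (f : I -> T -> R) :
  (forall i, P.-integrable setT (EFin \o f i)) ->
  P.-integrable setT (EFin \o (fun t => \sum_i f i t)).
Proof.
move=> fi; have := integrable_sum measurableT (index_enum I) (fun i _ => fi i).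
by move=> /(_ xpredT) H; apply: eq_integrable H => //= t _; rewrite /= sumEFin.
Qed.

Lemma integrableZR r f : P.-integrable setT (EFin \o f) ->
  P.-integrable setT (EFin \o (fun t => r * f t)).
Proof. by move=> fi; have := integrableZl measurableT r fi. Qed.

Lemma Ex_sum (I : finType) (f : I -> T -> R) :
  (forall i, P.-integrable setT (EFin \o f i)) ->
  Ex P (fun t => \sum_i f i t) = \sum_i Ex P (f i).
Proof.
move=> fi; rewrite /Ex.
elim: (index_enum I) => [|i s IHs].
  under eq_Rintegral do rewrite big_nil.
  by rewrite big_nil Rintegral_cst// mul0r.
under eq_Rintegral do rewrite big_cons.
rewrite big_cons RintegralD// ?IHs//.
have := integrable_sum measurableT s (fun i _ => fi i).
by move=> /(_ xpredT) H; apply: eq_integrable H => //= t _; rewrite /= sumEFin.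
Qed.

Lemma ExZ r f : P.-integrable setT (EFin \o f) ->
  Ex P (fun t => r * f t) = r * Ex P f.
Proof. by move=> fi; rewrite /Ex RintegralZl. Qed.

Lemma ExD f g : P.-integrable setT (EFin \o f) -> P.-integrable setT (EFin \o g) ->
  Ex P (fun t => f t + g t) = Ex P f + Ex P g.
Proof. by move=> fi gi; rewrite /Ex RintegralD. Qed.

Lemma Ex_cst r : Ex P (fun=> r) = r.
Proof. by rewrite /Ex Rintegral_cst//; have /= -> := probability_setT P; rewrite mulr1. Qed.

Lemma le1_integrable f : measurable_fun setT f -> (forall t, `|f t| <= 1) ->
  P.-integrable setT (EFin \o f).
Proof.
move=> mf f1; apply: (@le_integrable _ _ _ _ _ measurableT _ (cst 1%E)) => //=.
- exact/measurable_EFinP.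
- by move=> t _; rewrite normr1 lee_fin.
- by apply: finite_measure_integrable_cst.
Qed.

Lemma integrable_prod4 (f g h k : T -> R) :
  measurable_fun setT f -> measurable_fun setT g ->
  measurable_fun setT h -> measurable_fun setT k ->
  P.-integrable setT (fun t => (f t ^+ 4)%:E) ->
  P.-integrable setT (fun t => (g t ^+ 4)%:E) ->
  P.-integrable setT (fun t => (h t ^+ 4)%:E) ->
  P.-integrable setT (fun t => (k t ^+ 4)%:E) ->
  P.-integrable setT (EFin \o (fun t => f t * g t * h t * k t)).
Proof.
move=> mf mg mh mk fi gi hi ki.
have si := integrableD measurableT (integrableD measurableT fi gi)
  (integrableD measurableT hi ki).
apply: (le_integrable measurableT _ _ si) => /=.
  by apply/measurable_EFinP; do 3 apply: measurable_funM => //.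
move=> t _; rewrite lee_fin [leRHS]ger0_norm; last first.
  by rewrite !addr_ge0// exprn_even_ge0.
rewrite ler_norml.
(* The first two squares bound [2 |f g h k|] by [f^2 g^2 + h^2 k^2], the next two bound this by half
   the sum of the fourth powers, and the last four absorb the spare constant. *)
have := sqr_ge0 (f t * g t + h t * k t); have := sqr_ge0 (f t * g t - h t * k t).
have := sqr_ge0 (f t ^+ 2 - g t ^+ 2); have := sqr_ge0 (h t ^+ 2 - k t ^+ 2).
have := sqr_ge0 (f t ^+ 2); have := sqr_ge0 (g t ^+ 2).
have := sqr_ge0 (h t ^+ 2); have := sqr_ge0 (k t ^+ 2).
move: (f t) (g t) (h t) (k t) => x y z w *.
by apply/andP; split; nra.
Qed.

End expectation.

(** * Measurability of quaternionic matrices through real coordinates *)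

Section quaternion_measurability.
Context d (S : measurableType d) (R : realType).
Implicit Types f g : S -> quat R.

Definition measurable_quat f :=
  [/\ measurable_fun setT (fun s => qre (f s)), measurable_fun setT (fun s => qi (f s)),
      measurable_fun setT (fun s => qj (f s)) & measurable_fun setT (fun s => qk (f s))].

Lemma measurable_quatM f g : measurable_quat f -> measurable_quat g ->
  measurable_quat (fun s => f s * g s).
Proof.
move=> [f1 f2 f3 f4] [g1 g2 g3 g4].
by split; under eq_fun do rewrite quatME /=;
  repeat (first [assumption | apply: measurable_funB | apply: measurable_funD
                 | apply: measurable_funM]).
Qed.

Lemma measurable_qconj f : measurable_quat f -> measurable_quat (fun s => qconj (f s)).
Proof. by move=> [f1 f2 f3 f4]; split=> //=; exact: measurable_funN. Qed.

Lemma measurable_qnorm2 f : measurable_quat f ->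
  measurable_fun setT (fun s => qnorm2 (f s)).
Proof.
move=> [f1 f2 f3 f4]; rewrite /qnorm2.
by repeat (first [apply: measurable_funX | apply: measurable_funD]).
Qed.

End quaternion_measurability.

Section matrix_coordinates.
Context (R : realType) (m : nat).

(** A left inverse of [mxcoords]: it presents a function of a matrix as a function on
    [family_space], to which the results on laws and independence apply. *)
Definition mx_of_coords (z : family_space R ('I_m * 'I_m * 'I_4)%type) :
    'M[quat R]_m :=
  \matrix_(i, j) Quat (z (i, j, @Ordinal 4 0 isT)) (z (i, j, @Ordinal 4 1 isT))
    (z (i, j, @Ordinal 4 2 isT)) (z (i, j, @Ordinal 4 3 isT)).

Lemma mxcoordsK (T : Type) (U : T -> 'M[quat R]_m) t :
  mx_of_coords (fun p => mxcoords U p t) = U t.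
Proof. by apply/matrixP => i j; rewrite mxE /mxcoords /qcoord /=; case: (U t i j). Qed.

Lemma measurable_mx_of_coords i j : measurable_quat (fun z => mx_of_coords z i j).
Proof.
have mcoord (c : 'I_4) := @measurable_coord R _ (i, j, c).
by split; [have := mcoord (@Ordinal 4 0 isT)|have := mcoord (@Ordinal 4 1 isT)
  |have := mcoord (@Ordinal 4 2 isT)|have := mcoord (@Ordinal 4 3 isT)];
  apply: eq_measurable_fun => z _; rewrite mxE.
Qed.

Lemma measurable_quad i j k l :
  measurable_fun setT (fun z => quad (mx_of_coords z) i j k l).
Proof.
have mU := measurable_mx_of_coords.
by have [] : measurable_quat (fun z => qconj (mx_of_coords z k i) * mx_of_coords z k j
    * (qconj (mx_of_coords z l j) * mx_of_coords z l i));
  [apply: measurable_quatM; apply: measurable_quatM => //; exact: measurable_qconj|].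
Qed.

End matrix_coordinates.

(** * Moments of the entries of a permutation-invariant unitary matrix *)

Lemma perm_mulmxE (S : pzSemiRingType) (m n : nat) (s : 'S_m) (A : 'M[S]_(m, n)) i j :
  (perm_mx s *m A) i j = A (s i) j.
Proof. by rewrite -row_permE mxE. Qed.

Lemma mulmx_permE (S : pzSemiRingType) (m n : nat) (s : 'S_n) (A : 'M[S]_(m, n)) i j :
  (A *m perm_mx s) i j = A i (s^-1%g j).
Proof. by rewrite -[s in LHS]invgK -col_permE mxE. Qed.

Lemma sum_const_off (R : pzRingType) (m : nat) (e : 'I_m -> R) (k : 'I_m) (x : R) :
  (forall l, l != k -> e l = x) -> \sum_l e l = e k + (m%:R - 1) * x.
Proof.
move=> ex; rewrite (bigD1 k)//= (eq_bigr _ ex) sumr_const cardC1 card_ord.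
(* The index [k] excludes [m = 0], where the predecessor [m.-1] would not be [m - 1] in the ring. *)
congr (_ + _); case: m k e ex => [[]//|m] _ _ _.
by rewrite -natr1 addrK mulr_natl.
Qed.

Section moments.
Context d (T : measurableType d) (R : realType) (P : probability T R) (m : nat).
Variable U : T -> 'M[quat R]_m.

(** This one-sided form is shared by permutation-invariant, Haar and uniform permutation matrices,
    so that one computation serves all three. *)
Definition perm_inv_sides := forall s : 'S_m,
  same_law P (mxcoords U) (mxcoords (fun t => perm_mx s *m U t)) /\
  same_law P (mxcoords U) (mxcoords (fun t => U t *m perm_mx s)).

Hypothesis m_gt1 : (1 < m)%N.
Hypothesis mU : rv_family (mxcoords U).
Hypothesis UrU : forall t, U t *m adjmx (U t) = 1%:M.
Hypothesis UlU : forall t, adjmx (U t) *m U t = 1%:M.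
Hypothesis invU : perm_inv_sides.

Let mUrow s : rv_family (mxcoords (fun t => perm_mx s *m U t)).
Proof.
move=> [[i j] c]; rewrite /mxcoords; under eq_fun do rewrite perm_mulmxE.
exact: (mU (s i, j, c)).
Qed.

Let mUcol s : rv_family (mxcoords (fun t => U t *m perm_mx s)).
Proof.
move=> [[i j] c]; rewrite /mxcoords; under eq_fun do rewrite mulmx_permE.
exact: (mU (i, s^-1%g j, c)).
Qed.

Lemma Ex_perm_row s (G : 'M[quat R]_m -> R) :
  measurable_fun setT (fun z => G (mx_of_coords z)) ->
  Ex P (fun t => G (U t)) = Ex P (fun t => G (perm_mx s *m U t)).
Proof.
move=> mG; have := same_law_Ex mU (mUrow s) (invU s).1 mG.
by under [X in Ex P X = _]eq_fun do rewrite mxcoordsK;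
  under [X in _ = Ex P X]eq_fun do rewrite mxcoordsK.
Qed.

Lemma Ex_perm_col s (G : 'M[quat R]_m -> R) :
  measurable_fun setT (fun z => G (mx_of_coords z)) ->
  Ex P (fun t => G (U t)) = Ex P (fun t => G (U t *m perm_mx s)).
Proof.
move=> mG; have := same_law_Ex mU (mUcol s) (invU s).2 mG.
by under [X in Ex P X = _]eq_fun do rewrite mxcoordsK;
  under [X in _ = Ex P X]eq_fun do rewrite mxcoordsK.
Qed.

Lemma measurable_of_mx (G : 'M[quat R]_m -> R) :
  measurable_fun setT (fun z => G (mx_of_coords z)) ->
  measurable_fun setT (fun t => G (U t)).
Proof.
move=> mG; have := measurableT_comp mG (measurable_family mU).
by apply: eq_measurable_fun => t _ /=; rewrite mxcoordsK.
Qed.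

Lemma measurable_qnorm2_coords (k i : 'I_m) :
  measurable_fun setT (fun z => qnorm2 (mx_of_coords z k i) : R).
Proof. exact/measurable_qnorm2/measurable_mx_of_coords. Qed.

Lemma integrable_quad i j k l :
  P.-integrable setT (EFin \o (fun t => quad (U t) i j k l)).
Proof.
apply: le1_integrable => [|t]; last exact: quad_le1.
exact: (@measurable_of_mx (fun M => quad M i j k l) (measurable_quad i j k l)).
Qed.

Lemma normr_qnorm2_le1 k i t : `|qnorm2 (U t k i)| <= 1.
Proof. by rewrite ger0_norm ?qnorm2_ge0// qnorm2_le1. Qed.

Lemma integrable_qnorm2 k i :
  P.-integrable setT (EFin \o (fun t => qnorm2 (U t k i))).
Proof.
apply: le1_integrable => [|t]; last exact: normr_qnorm2_le1.
exact: (@measurable_of_mx (fun M => qnorm2 (M k i)) (measurable_qnorm2_coords k i)).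
Qed.

Let m0 : m%:R != 0 :> R.
Proof. by rewrite pnatr_eq0; case: m m_gt1. Qed.

Let m1 : m%:R - 1 != 0 :> R.
Proof. by rewrite subr_eq0 pnatr_eq1; case: m m_gt1 => [|[]]. Qed.

(** Row transpositions equate the means within a column, whose squared moduli sum to one. *)
Lemma Ex_qnorm2 k i : Ex P (fun t => qnorm2 (U t k i)) = m%:R^-1.
Proof.
have same l : Ex P (fun t => qnorm2 (U t l i)) = Ex P (fun t => qnorm2 (U t k i)).
  rewrite (@Ex_perm_row (tperm k l) (fun M => qnorm2 (M k i)) (measurable_qnorm2_coords k i)).
  by under [X in _ = Ex P X]eq_fun do rewrite perm_mulmxE tpermL.
have : \sum_l Ex P (fun t => qnorm2 (U t l i)) = 1.
  rewrite -Ex_sum; last by move=> l; exact: integrable_qnorm2.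
  by under eq_fun do rewrite sum_qnorm2//; rewrite Ex_cst.
under eq_bigr do rewrite same.
rewrite sumr_const card_ord => E.
by apply: (mulfI m0); rewrite mulr_natl E divff.
Qed.

(** A row and a column transposition carry any entry to any other, so a single fourth moment governs
    all diagonal coefficients. *)
Lemma Ex_quad_diag k i k' i' :
  Ex P (fun t => quad (U t) i i k k) = Ex P (fun t => qnorm2 (U t k' i') ^+ 2).
Proof.
rewrite (@Ex_perm_row (tperm k k') (fun M => quad M i i k k) (measurable_quad i i k k)).
under [X in Ex P X = _]eq_fun => t.
  rewrite quad_diag perm_mulmxE tpermL -quad_diag.
  over.
rewrite (@Ex_perm_col (tperm i i') (fun M => quad M i i k' k') (measurable_quad i i k' k')).
by under [X in Ex P X = _]eq_fun do rewrite quad_diag mulmx_permE tpermV tpermL.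
Qed.

(** For [m > 1], the kernel with unit diagonal, constant off-diagonal value and zero row sums;
    [sum_kcoef] shows that its quadratic form is [m * kappa2]. *)
Definition kcoef (i j : 'I_m) : R := if i == j then 1 else - (m%:R - 1)^-1.

(* Sums of [quad] over [l], or over [j] when [k = l], are deterministic or have a
   known mean, and transpositions equate the means of their off-diagonal terms. *)
Lemma Ex_quad k0 i0 i j k l : Ex P (fun t => quad (U t) i j k l) =
  m%:R^-1 * (i == j)%:R * (k == l)%:R
  - (1 - m%:R * Ex P (fun t => qnorm2 (U t k0 i0) ^+ 2)) / m%:R
    * kcoef i j * kcoef k l.
Proof.
set u := Ex P (fun t => qnorm2 (U t k0 i0) ^+ 2).
have off_l i' j' k' l' : k' != l' -> Ex P (fun t => quad (U t) i' j' k' k')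
    + (m%:R - 1) * Ex P (fun t => quad (U t) i' j' k' l') =
    if i' == j' then m%:R^-1 else 0.
  move=> kl; rewrite -(@sum_const_off _ _ (fun l => Ex P (fun t => quad (U t) i' j' k' l))).
    rewrite -Ex_sum; last by move=> ?; exact: integrable_quad.
    under eq_fun do rewrite sum_quad_row//.
    by case: eqP => _; rewrite ?Ex_qnorm2 ?Ex_cst.
  move=> l2 l2k; rewrite (@Ex_perm_row (tperm l' l2) (fun M => quad M i' j' k' l2)
    (measurable_quad i' j' k' l2)).
  congr Ex; apply/funext => t; rewrite /quad !perm_mulmxE tpermR tpermD//.
  by rewrite eq_sym.
have off_j i' j' k' : i' != j' -> Ex P (fun t => quad (U t) i' i' k' k')
    + (m%:R - 1) * Ex P (fun t => quad (U t) i' j' k' k') = m%:R^-1.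
  move=> ij; rewrite -(@sum_const_off _ _ (fun j => Ex P (fun t => quad (U t) i' j k' k'))).
    rewrite -Ex_sum; last by move=> ?; exact: integrable_quad.
    by under eq_fun do rewrite sum_quad_col//; rewrite Ex_qnorm2.
  move=> j2 j2i; rewrite (@Ex_perm_col (tperm j' j2) (fun M => quad M i' j2 k' k')
    (measurable_quad i' j2 k' k')).
  congr Ex; apply/funext => t; rewrite /quad !mulmx_permE tpermV tpermR tpermD//.
  by rewrite eq_sym.
have Eu i' k' : Ex P (fun t => quad (U t) i' i' k' k') = u by exact: Ex_quad_diag.
rewrite /kcoef; have [<-|ij] := eqVneq i j; have [<-|kl] := eqVneq k l;
  rewrite ?mulr1n ?mulr0n.
- by rewrite Eu; field.
- have := off_l i i k l kl; rewrite eqxx Eu => E.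
  by apply: (mulfI m1); rewrite -[LHS](addKr u) E; field; rewrite m0 m1.
- have := off_j i j k ij; rewrite Eu => E.
  by apply: (mulfI m1); rewrite -[LHS](addKr u) E; field; rewrite m0 m1.
(* With both pairs distinct, [off_j] gives the mean at [l = k], from which [off_l] gives the mean at
   [l <> k]. *)
have E1 := off_j i j k ij; rewrite Eu in E1.
have := off_l i j k l kl; rewrite (negbTE ij) => E2.
have {}E1 : Ex P (fun t => quad (U t) i j k k) = (m%:R^-1 - u) / (m%:R - 1).
  by rewrite -E1 addrC addKr mulrC mulKf.
rewrite {}E1 in E2; apply: (mulfI m1).
by rewrite -[LHS](addKr ((m%:R^-1 - u) / (m%:R - 1))) E2; field; rewrite m0 m1.
Qed.

End moments.

(** This brings in [kappa2]: the correction in [Ex_quad] is a product of a kernel in [i, j] and one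
    in [k, l], so the alternating word yields a product of two such quadratic forms. *)
Lemma sum_kcoef (R : realType) (m : nat) (x : 'I_m -> R) : (1 < m)%N ->
  \sum_i \sum_j kcoef R i j * (x i * x j) = m%:R * kappa2 x.
Proof.
move=> m_gt1.
have m0 : m%:R != 0 :> R by rewrite pnatr_eq0; case: m m_gt1 {x}.
have m1 : m%:R - 1 != 0 :> R.
  by rewrite subr_eq0 pnatr_eq1; case: m m_gt1 {x m0} => [|[]].
have E i : \sum_j kcoef R i j * (x i * x j) =
    x i ^+ 2 - (m%:R - 1)^-1 * \sum_(j | j != i) x i * x j.
  rewrite (bigD1 i)//= /kcoef eqxx mul1r expr2 mulr_sumr -sumrN; congr (_ + _).
  by apply: eq_bigr => j ji; rewrite eq_sym (negbTE ji) mulNr.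
rewrite (eq_bigr _ (fun i _ => E i)) sumrB -mulr_sumr /kappa2.
by field; rewrite m0 m1.
Qed.

(** * The fourth moment formula *)

Section fourth_moment.
Context d (T : measurableType d) (R : realType) (P : probability T R) (m : nat).
Variables L1 L2 : 'I_m -> T -> R.
Hypothesis m_gt1 : (1 < m)%N.
Hypotheses (mL1 : rv_family L1) (mL2 : rv_family L2).
Hypothesis iL1 : forall i, P.-integrable setT (fun t => (L1 i t ^+ 4)%:E).
Hypothesis iL2 : forall i, P.-integrable setT (fun t => (L2 i t ^+ 4)%:E).

Local Notation L := (pairfam L1 L2).

Let mL : rv_family L. Proof. by case=> i; [exact: mL1|exact: mL2]. Qed.

Let iL s : P.-integrable setT (fun t => (L s t ^+ 4)%:E).
Proof. by case: s => i; [exact: iL1|exact: iL2]. Qed.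

Definition mono s1 s2 s3 s4 t := L s1 t * L s2 t * L s3 t * L s4 t.

Lemma integrable_mono s1 s2 s3 s4 : P.-integrable setT (EFin \o mono s1 s2 s3 s4).
Proof. exact: integrable_prod4. Qed.

Definition mean s1 s2 s3 s4 := Ex P (mono s1 s2 s3 s4).

(** The constant [C], with each [qnorm2] replaced by its mean [m^-1]. The last sum comes from the
    alternating word: it is the contribution of the Kronecker term of [Ex_quad]. *)
Definition phi4_classical : R :=
  m%:R^-1 * (Ex P (fun t => \sum_i L1 i t ^+ 4 + \sum_i L2 i t ^+ 4)
    + 4 * (\sum_i \sum_k mean (inl i) (inl i) (inl i) (inr k) / m%:R)
    + 4 * (\sum_i \sum_k mean (inl i) (inl i) (inr k) (inr k) / m%:R)
    + 4 * (\sum_i \sum_k mean (inl i) (inr k) (inr k) (inr k) / m%:R)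
    + 2 * (\sum_i \sum_k mean (inl i) (inl i) (inr k) (inr k) / m%:R)).

(** Writes the product in the same mixed moments as the alternating word, so that the two can be
    compared term by term. *)
Lemma Ex_kappa2_prod :
  Ex P (fun t => kappa2 (fun i => L1 i t) * kappa2 (fun i => L2 i t)) =
  m%:R^-2 * \sum_i \sum_j \sum_k \sum_l
    kcoef R i j * kcoef R k l * mean (inl i) (inl j) (inr k) (inr l).
Proof.
have m0 : m%:R != 0 :> R by rewrite pnatr_eq0; case: m m_gt1.
transitivity (Ex P (fun t => m%:R^-2 * \sum_i \sum_j \sum_k \sum_l
    kcoef R i j * kcoef R k l * mono (inl i) (inl j) (inr k) (inr l) t)).
  (* Multiplying by [m^2] supplies each [kappa2] with the factor [m] that [sum_kcoef] requires. *)
  congr Ex; apply/funext => t; apply: (mulfI (expf_neq0 2 m0)).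
  rewrite mulVKf ?expf_neq0//.
  transitivity (m%:R * kappa2 (L1^~ t) * (m%:R * kappa2 (L2^~ t))); first by ring.
  rewrite -!sum_kcoef// mulr_suml; apply: eq_bigr => i _.
  rewrite mulr_suml; apply: eq_bigr => j _.
  rewrite mulr_sumr; apply: eq_bigr => k _.
  rewrite mulr_sumr; apply: eq_bigr => l _.
  by rewrite /mono /=; ring.
have iterm i j k l : P.-integrable setT (EFin \o (fun t =>
    kcoef R i j * kcoef R k l * mono (inl i) (inl j) (inr k) (inr l) t)).
  exact/integrableZR/integrable_mono.
rewrite ExZ; last by do 4 apply: integrable_sumR => ?.
congr (_ * _); rewrite Ex_sum => [|i]; last by do 3 apply: integrable_sumR => ?.
apply: eq_bigr => i _; rewrite Ex_sum => [|j]; last by do 2 apply: integrable_sumR => ?.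
apply: eq_bigr => j _; rewrite Ex_sum => [|k]; last by apply: integrable_sumR => ?.
apply: eq_bigr => k _; rewrite Ex_sum//.
by apply: eq_bigr => l _; rewrite ExZ//; exact: integrable_mono.
Qed.

Section with_matrix.
Variable U : T -> 'M[quat R]_m.
Hypothesis mU : rv_family (mxcoords U).
Hypothesis UrU : forall t, U t *m adjmx (U t) = 1%:M.
Hypothesis UlU : forall t, adjmx (U t) *m U t = 1%:M.
Hypothesis invU : perm_inv_sides P U.
Hypothesis indU : indep P (mxcoords U) L.

Section with_entry_function.
Variable G : 'M[quat R]_m -> R.
Hypothesis mG : measurable_fun setT (fun z => G (mx_of_coords z)).
Hypothesis G1 : forall t, `|G (U t)| <= 1.

Let iG : P.-integrable setT (EFin \o (fun t => G (U t))).
Proof. by apply: le1_integrable => //; exact: measurable_of_mx. Qed.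

Lemma integrable_mono_mx s1 s2 s3 s4 :
  P.-integrable setT (EFin \o (fun t => mono s1 s2 s3 s4 t * G (U t))).
Proof.
apply: (le_integrable measurableT _ _ (integrable_mono s1 s2 s3 s4)) => /=.
  apply/measurable_EFinP; apply: measurable_funM; last exact: measurable_of_mx.
  by have /measurable_EFinP := measurable_int _ (integrable_mono s1 s2 s3 s4).
by move=> t _; rewrite lee_fin normrM ler_piMr.
Qed.

(** Independence of the matrix from the pair of diagonals enters here; the bound on [G] and the
    fourth moments make both factors integrable. *)
Lemma Ex_mono_mx s1 s2 s3 s4 :
  Ex P (fun t => mono s1 s2 s3 s4 t * G (U t)) =
  mean s1 s2 s3 s4 * Ex P (fun t => G (U t)).
Proof.
have mz : measurable_fun setT (fun z : family_space R ('I_m + 'I_m)%type =>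
    z s1 * z s2 * z s3 * z s4).
  by repeat (first [exact: measurable_coord | apply: measurable_funM]).
have iGz : P.-integrable setT (fun t =>
    (G (mx_of_coords (fun p => mxcoords U p t)))%:E).
  by under eq_fun do rewrite mxcoordsK.
have := indep_integrable_Ex mU mL indU mG mz iGz (integrable_mono s1 s2 s3 s4).
under [X in Ex P X = _]eq_fun do rewrite mxcoordsK mulrC.
by under [X in _ = Ex P X * _]eq_fun do rewrite mxcoordsK; rewrite mulrC.
Qed.

End with_entry_function.

(** The entry [(k0, i0)] is arbitrary, which later lets [p] be computed from any entries. *)
Lemma phi4_formula k0 i0 :
  phi4 P (fun t => rdiag (fun i => L1 i t) + adjmx (U t) *m rdiag (fun i => L2 i t) *m U t)
  = phi4_classical
    - 2 * (1 - m%:R * Ex P (fun t => qnorm2 (U t k0 i0) ^+ 2))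
      * Ex P (fun t => kappa2 (fun i => L1 i t) * kappa2 (fun i => L2 i t)).
Proof.
have m0 : m%:R != 0 :> R by rewrite pnatr_eq0; case: m m_gt1.
have iN s1 s2 s3 s4 k i : P.-integrable setT (EFin \o (fun t =>
    mono s1 s2 s3 s4 t * qnorm2 (U t k i))).
  apply: (@integrable_mono_mx (fun M => qnorm2 (M k i))) => [|t].
    exact: measurable_qnorm2_coords.
  exact: normr_qnorm2_le1.
have iq s1 s2 s3 s4 i j k l : P.-integrable setT (EFin \o (fun t =>
    mono s1 s2 s3 s4 t * quad (U t) i j k l)).
  apply: (@integrable_mono_mx (fun M => quad M i j k l)) => [|t].
    exact: measurable_quad.
  exact: quad_le1.
have EN s1 s2 s3 s4 k i : Ex P (fun t => mono s1 s2 s3 s4 t * qnorm2 (U t k i)) =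
    mean s1 s2 s3 s4 / m%:R.
  rewrite (@Ex_mono_mx (fun M => qnorm2 (M k i))) ?Ex_qnorm2// => [|t].
    exact: measurable_qnorm2_coords.
  exact: normr_qnorm2_le1.
have Eq s1 s2 s3 s4 i j k l : Ex P (fun t => mono s1 s2 s3 s4 t * quad (U t) i j k l) =
    mean s1 s2 s3 s4 * Ex P (fun t => quad (U t) i j k l).
  rewrite (@Ex_mono_mx (fun M => quad M i j k l))// => [|t].
    exact: measurable_quad.
  exact: quad_le1.
(* [S0] collects the two pure powers; [S1] to [S4] are the mixed cyclic classes of [retr_pow4_conj],
   with [S4] the alternating one. *)
pose S0 t := \sum_i L1 i t ^+ 4 + \sum_i L2 i t ^+ 4.
pose S1 t := \sum_i \sum_k mono (inl i) (inl i) (inl i) (inr k) t * qnorm2 (U t k i).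
pose S2 t := \sum_i \sum_k mono (inl i) (inl i) (inr k) (inr k) t * qnorm2 (U t k i).
pose S3 t := \sum_i \sum_k mono (inl i) (inr k) (inr k) (inr k) t * qnorm2 (U t k i).
pose S4 t := \sum_i \sum_j \sum_k \sum_l
  mono (inl i) (inl j) (inr k) (inr l) t * quad (U t) i j k l.
have iS0 : P.-integrable setT (EFin \o S0).
  exact: (integrableD measurableT
    (@integrable_sumR _ _ _ P _ (fun i t => L1 i t ^+ 4) iL1)
    (@integrable_sumR _ _ _ P _ (fun i t => L2 i t ^+ 4) iL2)).
have iS1 : P.-integrable setT (EFin \o S1) by do 2 apply: integrable_sumR => ?.
have iS2 : P.-integrable setT (EFin \o S2) by do 2 apply: integrable_sumR => ?.
have iS3 : P.-integrable setT (EFin \o S3) by do 2 apply: integrable_sumR => ?.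
have iS4 : P.-integrable setT (EFin \o S4) by do 4 apply: integrable_sumR => ?.
have ES1 : Ex P S1 = \sum_i \sum_k mean (inl i) (inl i) (inl i) (inr k) / m%:R.
  rewrite Ex_sum => [|i]; last by apply: integrable_sumR => ?.
  by apply: eq_bigr => i _; rewrite Ex_sum//; apply: eq_bigr.
have ES2 : Ex P S2 = \sum_i \sum_k mean (inl i) (inl i) (inr k) (inr k) / m%:R.
  rewrite Ex_sum => [|i]; last by apply: integrable_sumR => ?.
  by apply: eq_bigr => i _; rewrite Ex_sum//; apply: eq_bigr.
have ES3 : Ex P S3 = \sum_i \sum_k mean (inl i) (inr k) (inr k) (inr k) / m%:R.
  rewrite Ex_sum => [|i]; last by apply: integrable_sumR => ?.
  by apply: eq_bigr => i _; rewrite Ex_sum//; apply: eq_bigr.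
have ES4 : Ex P S4 = \sum_i \sum_j \sum_k \sum_l
    mean (inl i) (inl j) (inr k) (inr l) * Ex P (fun t => quad (U t) i j k l).
  rewrite Ex_sum => [|i]; last by do 3 apply: integrable_sumR => ?.
  apply: eq_bigr => i _; rewrite Ex_sum => [|j]; last by do 2 apply: integrable_sumR => ?.
  apply: eq_bigr => j _; rewrite Ex_sum => [|k]; last by apply: integrable_sumR => ?.
  by apply: eq_bigr => k _; rewrite Ex_sum//; apply: eq_bigr.
set u := Ex P (fun t => qnorm2 (U t k0 i0) ^+ 2).
set K := Ex P (fun t => kappa2 _ * kappa2 _).
(* In [Ex_quad] the Kronecker term produces the diagonal sum, and the [kcoef] term produces the
   multiple of [K]. *)
have ES4' : Ex P S4 =
    \sum_i \sum_k mean (inl i) (inl i) (inr k) (inr k) / m%:R - (1 - m%:R * u) * m%:R * K.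
  rewrite ES4 /K Ex_kappa2_prod.
  transitivity (\sum_i \sum_j \sum_k \sum_l
     (mean (inl i) (inl j) (inr k) (inr l) / m%:R * (i == j)%:R * (k == l)%:R
      - (1 - m%:R * u) / m%:R *
        (kcoef R i j * kcoef R k l * mean (inl i) (inl j) (inr k) (inr l)))).
    do 4 (apply: eq_bigr => ? _).
    by rewrite (Ex_quad m_gt1 mU UrU UlU invU k0 i0) -/u; ring.
  have sumrB2 (x y : 'I_m -> 'I_m -> R) :
      \sum_i \sum_j x i j - \sum_i \sum_j y i j = \sum_i \sum_j (x i j - y i j).
    by rewrite -sumrB; apply: eq_bigr => i _; rewrite sumrB.
  have -> : (1 - m%:R * u) * m%:R *
      (m%:R^-2 * (\sum_i \sum_j \sum_k \sum_l
        kcoef R i j * kcoef R k l * mean (inl i) (inl j) (inr k) (inr l))) =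
    \sum_i \sum_j \sum_k \sum_l (1 - m%:R * u) / m%:R *
        (kcoef R i j * kcoef R k l * mean (inl i) (inl j) (inr k) (inr l)).
    rewrite mulrA (_ : _ * m%:R^-2 = (1 - m%:R * u) / m%:R); last by field.
    rewrite mulr_sumr; apply: eq_bigr => i _.
    rewrite mulr_sumr; apply: eq_bigr => j _.
    rewrite mulr_sumr; apply: eq_bigr => k _.
    by rewrite mulr_sumr.
  rewrite -sumrB; apply: eq_bigr => i _.
  under eq_bigr do rewrite -sumrB2.
  rewrite sumrB; congr (_ - _).
  (* The Kronecker factors leave only [j = i] and [l = k]. *)
  rewrite (bigD1 i)//= [X in _ + X]big1 ?addr0 => [|j ji]; last first.
    by do 2 (apply: big1 => ? _); rewrite eq_sym (negbTE ji) mulr0 mul0r.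
  apply: eq_bigr => k _; rewrite (bigD1 k)//= big1 ?addr0 => [|l lk]; last first.
    by rewrite [k == l]eq_sym (negbTE lk) mulr0.
  by rewrite !eqxx !mulr1.
have -> : phi4 P (fun t => rdiag (fun i => L1 i t)
      + adjmx (U t) *m rdiag (fun i => L2 i t) *m U t) =
    Ex P (fun t => m%:R^-1 * (S0 t + 4 * S1 t + 4 * S2 t + 4 * S3 t + 2 * S4 t)).
  congr Ex; apply/funext => t; congr (_ * _).
  exact: (retr_pow4_conj (fun i => L1 i t) (fun i => L2 i t) (UrU t)).
have iD f g : P.-integrable setT (EFin \o f) -> P.-integrable setT (EFin \o g) ->
    P.-integrable setT (EFin \o (fun t => f t + g t : R)).
  by move=> fi gi; exact: (integrableD measurableT fi gi).
have i1 := integrableZR 4 iS1; have i2 := integrableZR 4 iS2.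
have i3 := integrableZR 4 iS3; have i4 := integrableZR 2 iS4.
have i01 := iD _ _ iS0 i1; have i02 := iD _ _ i01 i2; have i03 := iD _ _ i02 i3.
rewrite (ExZ m%:R^-1 (iD _ _ i03 i4)) (ExD i03 i4) (ExD i02 i3) (ExD i01 i2).
rewrite (ExD iS0 i1) (ExZ 4 iS1) (ExZ 4 iS2) (ExZ 4 iS3) (ExZ 2 iS4).
rewrite ES4' ES1 ES2 ES3 /phi4_classical -/S0.
by field.
Qed.

End with_matrix.
End fourth_moment.

(** * Uniformly random permutation matrices *)

Section uniform_permutation.
Context d (T : measurableType d) (R : realType) (P : probability T R) (m : nat).
Variable sigma : T -> 'S_m.
Hypothesis unif : uniform_perm P sigma.

Let preimE (E : set 'S_m) :
  sigma @^-1` E = \bigcup_(s in E) (sigma @^-1` [set s]).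
Proof.
by apply/seteqP; split=> t /=; [move=> Et; exists (sigma t)|move=> [s Es /= ->]].
Qed.

Let finS (E : set 'S_m) : finite_set E.
Proof. exact: (sub_finite_set (@subsetT _ E) (@finite_finset _ setT)). Qed.

Lemma measurable_perm_event (E : set 'S_m) : measurable (sigma @^-1` E).
Proof.
by rewrite preimE; apply: fin_bigcup_measurable => // s _; have [] := unif s.
Qed.

(** An injective self-map of a finite set is a bijection, and it only rearranges equiprobable atoms.
    Left and right translations are the instances used for invariance. *)
Lemma uniform_perm_inj (g : 'S_m -> 'S_m) (E : set 'S_m) : injective g ->
  P (sigma @^-1` E) = P ((g \o sigma) @^-1` E).
Proof.
move=> g_inj.
have trivF (F : set 'S_m) : trivIset F (fun s => sigma @^-1` [set s]).
  by move=> s s' _ _ [t /= []] <- <-.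
have mF s : measurable (sigma @^-1` [set s]) by have [] := unif s.
rewrite comp_preimage preimE [in RHS]preimE !measure_fin_bigcup//.
rewrite (@reindex_fsbig _ _ _ _ _ g (g @^-1` E) E).
  by apply: eq_fsbigr => s _; exact: (etrans (unif (g s)).2 (esym (unif s).2)).
split=> [s|s s' _ _ /g_inj|s Es]//=.
by exists (invF g_inj s); rewrite /= ?f_invF.
Qed.

Lemma perm_mx_rv_family :
  rv_family (mxcoords (fun t => (perm_mx (sigma t) : 'M[quat R]_m))).
Proof.
move=> p _ B mB; rewrite setTI.
exact: (measurable_perm_event
  [set u : 'S_m | B (qcoord p.2 ((perm_mx u : 'M[quat R]_m) p.1.1 p.1.2))]).
Qed.

Lemma perm_mx_inv_sides : perm_inv_sides P (fun t => (perm_mx (sigma t) : 'M[quat R]_m)).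
Proof.
move=> s; split=> A mA.
  have := @uniform_perm_inj (fun u => s * u)%g [set u : 'S_m | forall p : 'I_m * 'I_m * 'I_4,
     A p (qcoord p.2 ((perm_mx u : 'M[quat R]_m) p.1.1 p.1.2))] (mulgI s).
  rewrite /fam_event /mxcoords => ->; congr (P _); apply/seteqP.
  by split=> t /= h p; have := h p; rewrite perm_mxM.
have := @uniform_perm_inj (fun u => u * s)%g [set u : 'S_m | forall p : 'I_m * 'I_m * 'I_4,
   A p (qcoord p.2 ((perm_mx u : 'M[quat R]_m) p.1.1 p.1.2))] (mulIg s).
rewrite /fam_event /mxcoords => ->; congr (P _); apply/seteqP.
by split=> t /= h p; have := h p; rewrite perm_mxM.
Qed.

End uniform_permutation.

Lemma adjmx_perm (R : comNzRingType) (m : nat) (s : 'S_m) :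
  adjmx (perm_mx s : 'M[quat R]_m) = perm_mx s^-1.
Proof.
apply/matrixP => i j; rewrite !mxE.
have -> : (s^-1%g i == j) = (s j == i) by rewrite -(inj_eq (@perm_inj _ s)) permKV eq_sym.
by case: (_ == _); rewrite ?mulr1n ?mulr0n (quat0E, quat1E); apply: quatP; rewrite //= oppr0.
Qed.

Lemma perm_mx_unitary (R : comNzRingType) (m : nat) (s : 'S_m) :
  (perm_mx s : 'M[quat R]_m) *m adjmx (perm_mx s) = 1%:M /\
  adjmx (perm_mx s) *m (perm_mx s : 'M[quat R]_m) = 1%:M.
Proof. by rewrite adjmx_perm -!perm_mxM mulgV mulVg perm_mx1. Qed.

(** The entries 0 and 1 lie in all three algebras, so Haar invariance can be specialised to
    permutation matrices. *)
Lemma beta_orthogonal_perm (R : comNzRingType) (beta m : nat) (s : 'S_m) :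
  beta_orthogonal beta (perm_mx s : 'M[quat R]_m).
Proof.
split; last exact: perm_mx_unitary.
move=> i j; rewrite !mxE /in_beta.
by case: (s i == j); rewrite ?mulr1n ?mulr0n (quat0E, quat1E) /= !eqxx; do ?case: ifP.
Qed.

(** Entries are 0 or 1, so the fourth moment equals the second, [m^-1], and the correction in
    [phi4_formula] vanishes. *)
Lemma qnorm2_perm (R : comNzRingType) (m : nat) (s : 'S_m) i j :
  qnorm2 ((perm_mx s : 'M[quat R]_m) i j) ^+ 2 = qnorm2 ((perm_mx s : 'M[quat R]_m) i j).
Proof.
rewrite !mxE; case: (_ == _); rewrite ?mulr1n ?mulr0n (quat0E, quat1E) /qnorm2 /=; ring.
Qed.

Theorem mainTheorem6 (d : measure_display) (T : measurableType d) (R : realType)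
  (P : probability T R) (beta m : nat)
  (L1 L2 : 'I_m -> T -> R) (Qs Q : T -> 'M[quat R]_m) (sigma : T -> 'S_m) :
  (1 < m)%N -> beta \in [:: 1%N; 2%N; 4%N] ->
  (* Lambda_1, Lambda_2: independent random real diagonal matrices
     with finite fourth moments *)
  rv_family L1 -> rv_family L2 ->
  (forall i, P.-integrable setT (fun t => (L1 i t ^+ 4)%:E)) ->
  (forall i, P.-integrable setT (fun t => (L2 i t ^+ 4)%:E)) ->
  indep P L1 L2 ->
  (* Q_s: random beta-orthogonal permutation-invariant matrix *)
  random_beta_orth beta Qs -> perm_invariant P Qs ->
  (* Pi = perm_mx sigma: uniformly random permutation matrix *)
  uniform_perm P sigma ->
  (* Q: beta-Haar distributed *)
  beta_haar P beta Q ->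
  (* known fact: fourth moment of entries of a beta-Haar matrix *)
  (forall i j, Ex P (fun t => qnorm2 (Q t i j) ^+ 2)
               = (beta%:R + 2) / (m%:R * (m%:R * beta%:R + 2))) ->
  (* independence of Q_s, Pi, Q from (Lambda_1, Lambda_2) *)
  indep P (mxcoords Qs) (pairfam L1 L2) ->
  indep P (mxcoords (fun t => (perm_mx (sigma t) : 'M[quat R]_m))) (pairfam L1 L2) ->
  indep P (mxcoords Q) (pairfam L1 L2) ->
  Ex P (fun t => kappa2 (fun i => L1 i t) * kappa2 (fun i => L2 i t)) != 0 ->
  let m4 := phi4 P (fun t => rdiag (fun i => L1 i t)
                     + adjmx (Qs t) *m rdiag (fun i => L2 i t) *m Qs t) in
  let m4c := phi4 P (fun t => rdiag (fun i => L1 i t)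
                     + adjmx (perm_mx (sigma t)) *m rdiag (fun i => L2 i t)
                       *m perm_mx (sigma t)) in
  let m4f := phi4 P (fun t => rdiag (fun i => L1 i t)
                     + adjmx (Q t) *m rdiag (fun i => L2 i t) *m Q t) in
  m4c != m4f /\
  forall i j k l : 'I_m,
    let p := (1 - m%:R * Ex P (fun t => qnorm2 (Qs t i j) ^+ 2))
             / (1 - m%:R * Ex P (fun t => qnorm2 (Q t k l) ^+ 2)) in
    m4 = p * m4f + (1 - p) * m4c /\ p = (m4c - m4) / (m4c - m4f).
Proof.
move=> m_gt1 beta_124 mL1 mL2 iL1 iL2 _ [mQs QsP] invQs unif [[mQ QP] haarQ] fourthQ
  indQs indPi indQ K0 m4 m4c m4f.
have m0 : m%:R != 0 :> R by rewrite pnatr_eq0 -lt0n ltnW.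
have formula := phi4_formula m_gt1 mL1 mL2 iL1 iL2.
(* Each side is two-sided invariance with the identity as the other permutation. *)
have invQs' : perm_inv_sides P Qs.
  move=> s; split.
    have := invQs s 1%g; rewrite perm_mx1.
    by under [X in same_law P _ (mxcoords X)]eq_fun do rewrite mulmx1.
  have := invQs 1%g s; rewrite perm_mx1.
  by under [X in same_law P _ (mxcoords X)]eq_fun do rewrite mul1mx.
have invQ : perm_inv_sides P Q.
  by move=> s; exact: haarQ (beta_orthogonal_perm _ _ s).
have Es i j : m4 = phi4_classical P L1 L2
    - 2 * (1 - m%:R * Ex P (fun t => qnorm2 (Qs t i j) ^+ 2))
      * Ex P (fun t => kappa2 (fun i => L1 i t) * kappa2 (fun i => L2 i t)).
  by apply: formula => // t; have [_ []] := QsP t.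
have Ef i j : m4f = phi4_classical P L1 L2
    - 2 * (1 - m%:R * Ex P (fun t => qnorm2 (Q t i j) ^+ 2))
      * Ex P (fun t => kappa2 (fun i => L1 i t) * kappa2 (fun i => L2 i t)).
  by apply: formula => // t; have [_ []] := QP t.
have mPi := perm_mx_rv_family unif; have invPi := perm_mx_inv_sides unif.
have unitPi t := perm_mx_unitary R (sigma t).
have Ec : m4c = phi4_classical P L1 L2.
  have i0 : 'I_m by exact: Ordinal (ltnW m_gt1).
  rewrite /m4c (formula (fun t => perm_mx (sigma t)) mPi _ _ invPi indPi i0 i0).
  - under eq_fun do rewrite qnorm2_perm.
    rewrite (Ex_qnorm2 m_gt1 mPi _ invPi) ?divff// ?subrr ?mulr0 ?mul0r ?subr0//.
    by move=> t; have [] := unitPi t.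
  - by move=> t; have [] := unitPi t.
  - by move=> t; have [] := unitPi t.
clearbody m4 m4c m4f; set K := Ex P _ in K0 Es Ef.
(* The known Haar moment makes this factor [(m - 1) * beta / (m * beta + 2)], nonzero because
   [m > 1] and [beta > 0]. *)
have wf i j : 1 - m%:R * Ex P (fun t => qnorm2 (Q t i j) ^+ 2) != 0.
  have b0 : (0 : R) < beta%:R.
    by rewrite ltr0n; move: beta_124; rewrite !inE => /or3P[] /eqP ->.
  have m1 : (1 : R) < m%:R by rewrite ltr1n.
  have D0 : m%:R * beta%:R + 2 != 0 :> R by rewrite gt_eqF//; nra.
  rewrite fourthQ (_ : _ - _ = (m%:R - 1) * beta%:R / (m%:R * beta%:R + 2)); last first.
    by field; rewrite m0 D0.
  by rewrite !mulf_neq0 ?invr_eq0 ?subr_eq0// ?(gt_eqF m1)// (gt_eqF b0).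
(* The difference is [2 * K] times the factor in [wf], and [K] is nonzero by assumption. *)
have m4cf : m4c != m4f.
  have i0 : 'I_m by exact: Ordinal (ltnW m_gt1).
  rewrite Ec (Ef i0 i0) eq_sym subr_eq addrC -subr_eq subrr eq_sym.
  by rewrite !mulf_neq0// pnatr_eq0.
split; [exact: m4cf|move=> i j k l p].
have w0 := wf k l.
(* The two differences are [2 * K] times the denominator and the numerator of [p]; both claims are
   rearrangements of this identity. *)
have Ep : p * (m4c - m4f) = m4c - m4.
  by rewrite Ec (Es i j) (Ef k l) /p; field.
split; last by rewrite -Ep mulfK// subr_eq0.
by rewrite mulrBl mul1r addrCA -mulrBr -[LHS](subKr m4c) -Ep; ring.
Qed.
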